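(* There is an absolute constant $c$ such that the following holds. Let $H$ be a graph with $k$ vertices and let $G=(V,E)$ be a graph with $n$ vertices and at most $(1-\epsilon)2^{-\binom{k}{2}}n^k$ labeled induced copies of $H$. Then there is a subset $S \subset V$ with $|S|=\lfloor n/2 \rfloor$ and $$\left|e(S)-\frac{n^2}{16}\right| \geq \epsilon\, c^{-k} n^2.$$
   Context: All graphs are finite and simple. A labeled induced copy of $H$ in $G$ is an injective map $V(H)\to V(G)$ under which two vertices of $H$ are adjacent if and only if their images are adjacent in $G$. $e(S)$ denotes the number of edges of $G$ with both endpoints in $S$.
   Formalization: The formal theorem excludes G = K_4, where the claim fails: every 2-set S has e(S) = 1 = n^2/16, while for H two isolated vertices and ε = 1 there are no induced copies; it also makes explicit that the constant c is positive. *)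

(* Defs.v *)
From HB Require Import structures.
From mathcomp Require Import all_boot all_order all_algebra.
From mathcomp Require Import reals.
Set Implicit Arguments.
Unset Strict Implicit.
Unset Printing Implicit Defensive.

Record sgraph := SGraph {
  vertex :> finType;
  adj : rel vertex;
  adj_sym : symmetric adj;
  adj_irr : irreflexive adj }.

Definition edges (G : sgraph) : {set {set G}} :=
  [set [set x.1; x.2] | x : G * G & adj x.1 x.2].

Definition edges_in (G : sgraph) (S : {set G}) : nat :=
  #|[set A in edges G | A \subset S]|.

Definition induced_copies (H G : sgraph) : {set {ffun H -> G}} :=
  [set f : {ffun H -> G} |
    injectiveb f && [forall u, forall v, adj (f u) (f v) == adj u v]].

(* Used to exclude G = K_4, where every S with #|S| = 2 spans exactly
   1 = 4^2/16 edge: with H two isolated vertices and eps = 1 there are no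
   induced copies of H, yet the discrepancy is 0 for every such S. *)
Definition complete_graph (G : sgraph) : Prop :=
  forall u v : G, u != v -> adj u v.

(* Main.v *)
Require Import Defs.
From mathcomp Require Import all_boot all_order all_algebra.
From mathcomp Require Import reals.
From mathcomp Require Import ring lra zify.
Set Implicit Arguments.
Unset Strict Implicit.
Unset Printing Implicit Defensive.
Import Order.TTheory GRing.Theory Num.Theory.
Local Open Scope ring_scope.

(** Let [n] be the order of [G] and let [D] be the largest deviation
    |e(S) - n^2/16| over the half sets [S], those with [n./2] vertices.  The
    theorem says that a small [D] forces many induced copies of [H], and what
    has to be shown is
      #copies >= 2^-C(k,2) (n^k - 6^k delta n^(k-2)),  delta = O(D),
    an error linear in [D]: with the assumed upper bound on the number of
    copies it gives eps n^2 <= 6^k delta at once.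

    From half sets to all cuts ([half_weight_bias_le], [bilform_cut_le],
    [bias_cut_le]).  The bias of a pair of distinct vertices is 1/2 for an edge
    and -1/2 for a non-edge.  On a half set the quadratic form of the bias is
    at most 2D + n in absolute value.  A value 1/2 on the diagonal makes this form, or its
    negative, convex along every move of weight from one vertex to another, so
    that its maximum over fractional half sets is attained at a genuine one
    ([bilform_le_of_indicators]).  Polarizing around a constant function, the
    bilinear form of the bias is at most 54 (2D + n), again in absolute value,
    on all pairs of functions with values in [0, 1].

    The linear term ([order_le_deviation]).  The half sets of any graph
    other than the complete graph on four vertices deviate by a constant times
    [n], so the term [n] is itself O(D).  Exchanging one vertex of a half set for another changes
    its number of edges by at most 2D, hence any two vertices have nearly the
    same neighbours; by symmetry of adjacency such a graph is nearly empty or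
    nearly complete, and then its half sets do not have about n^2/16 edges.
    For 0 < n < 8 it suffices that n^2/16 is not an integer, except for n = 4,
    which is where the complete graph escapes.

    Embedding ([copies_extending_ge]).  The vertices of [H] are placed one
    after the other; each unplaced vertex [j] carries a weight function on its
    candidates.  Placing [h] at [x] should halve the total weight of each [j];
    the amount by which it falls short of half, summed over [x] with the weights
    of [h], is a single value of the bilinear form, up to n/2 for injectivity,
    and so at most delta ([total_shortfall_le]).  When more than half survives, the weight of [j]
    is scaled down to half.  This scaling keeps the loss exponential in k: the
    error of a step is delta times a product of the weights of all unplaced
    vertices but two, and thanks to the scaling each earlier placement has
    halved these weights, as it has those of the main term.  Relative to the
    main term, an earlier placement thus costs only a factor 4, and 6 leaves
    room for adding up the errors of all steps.  If the weights were merely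
    bounded by [n], the loss would be of order 2^(k^2/2). *)

(** * Counting edges inside a set *)

(** Each edge is the pair of its ends in exactly two orders. *)
Lemma edges_in_double (G : sgraph) (S : {set G}) :
  (edges_in S).*2 = (\sum_(x in S) \sum_(y in S) adj x y)%N.
Proof.
pose ends (z : G * G) := [set z.1; z.2].
pose D := [set z : G * G | [&& z.1 \in S, z.2 \in S & adj z.1 z.2]].
transitivity #|D|; last first.
  rewrite pair_big /= -sum1_card [RHS](bigID (fun z => adj z.1 z.2)) /=.
  rewrite [X in (_ + X)%N]big1 ?addn0; last by move=> z /andP[_ /negbTE ->].
  apply: eq_big => [z|z]; first by rewrite inE andbA.
  by rewrite inE => /and3P[_ _ ->].
rewrite -sum1_card (partition_big_imset ends) /=.
have -> : ends @: D = [set A in edges G | A \subset S].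
  apply/setP => A; rewrite inE; apply/imsetP/andP => [[z zD ->]|[]].
    move: zD; rewrite inE => /and3P[z1S z2S az]; split.
      by apply/imsetP; exists z; rewrite // inE.
    by apply/subsetP => x; rewrite !inE => /orP[] /eqP ->.
  case/imsetP => z; rewrite inE => az -> /subsetP sS.
  by exists z; rewrite // inE az !sS ?inE ?eqxx ?orbT.
rewrite (eq_bigr (fun=> 2%N)); first by rewrite sum_nat_const muln2.
move=> A; rewrite inE => /andP[/imsetP[[a b]]]; rewrite inE /= => ab -> /subsetP sS.
have a_b : a != b by apply/eqP => E; move: ab; rewrite E adj_irr.
have aS : a \in S by rewrite sS ?inE ?eqxx.
have bS : b \in S by rewrite sS ?inE ?eqxx ?orbT.
have -> : 2%N = #|[set (a, b); (b, a)]|.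
  by rewrite cards2 xpair_eqE (negbTE a_b).
rewrite sum1_card; apply: eq_card => -[x y].
rewrite [LHS]inE /= inE /= !inE /= !xpair_eqE.
apply/andP/orP => [[/and3P[_ _ xy] /eqP E]|[]/andP[/eqP -> /eqP ->]].
- have x_y : x != y by apply/eqP => E'; move: xy; rewrite E' adj_irr.
  have := set21 x y; have := set22 x y; rewrite -/(ends (x, y)) E /= !inE.
  case/orP=> /eqP ey; case/orP=> /eqP ex; rewrite ex ey ?eqxx in x_y *;
    by [|left|right].
- by rewrite aS bS ab.
- by rewrite aS bS adj_sym ab /ends /= setUC.
Qed.

Lemma exists_subset_of_card (T : finType) (A : {set T}) (m : nat) :
  (m <= #|A|)%N -> exists2 B : {set T}, B \subset A & #|B| = m.
Proof.
move=> mA; have : (0 < #|[set B : {set T} | B \subset A & #|B| == m]|)%N.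
  by rewrite cards_draws bin_gt0.
by case/card_gt0P => B; rewrite inE => /andP[? /eqP]; exists B.
Qed.

Lemma exists_set_between (T : finType) (A B : {set T}) (m : nat) :
  A \subset B -> (#|A| <= m <= #|B|)%N ->
  exists C : {set T}, [/\ A \subset C, C \subset B & #|C| = m].
Proof.
move=> sAB /andP[Am mB].
have [|C sC cC] := @exists_subset_of_card _ (B :\: A) (m - #|A|)%N.
  by rewrite cardsD (setIidPr sAB) leq_sub2r.
exists (A :|: C); split; first exact: subsetUl.
- by rewrite subUset sAB (subset_trans sC (subsetDl _ _)).
rewrite cardsU cC.
have -> : A :&: C = set0.
  apply/eqP; rewrite -subset0; apply/subsetP => x; rewrite inE => /andP[xA /(subsetP sC)].
  by rewrite inE xA.
by rewrite cards0; lia.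
Qed.

(** * Vertex exchanges *)

(** When [u] replaces [v] next to a set [T], the edges gained are the members of
    [T] that lie here, and the edges lost those that lie in
    [private_nbrs v u]. *)
Definition private_nbrs (G : sgraph) (u v : G) : {set G} :=
  [set w | [&& w != u, w != v, adj u w & ~~ adj v w]].

Lemma edges_in_setU1 (G : sgraph) (u : G) (T : {set G}) :
  u \notin T -> edges_in (u |: T) = (edges_in T + \sum_(x in T) adj u x)%N.
Proof.
move=> uT; apply: double_inj; rewrite doubleD !edges_in_double.
rewrite big_setU1 //= big_setU1 //= adj_irr add0n.
have -> : (\sum_(x in T) \sum_(y in u |: T) adj x y
           = \sum_(x in T) adj u x + \sum_(x in T) \sum_(y in T) adj x y)%N.
  rewrite -big_split /=; apply: eq_bigr => x xT.
  by rewrite big_setU1 //= [adj x u]adj_sym.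
by rewrite addnA addnC addnn.
Qed.

Definition half_sets_within (R : realFieldType) (G : sgraph) (D : R) : Prop :=
  forall S : {set G}, #|S| = #|G|./2 ->
    `| (edges_in S)%:R - #|G|%:R ^+ 2 / 16 | <= D.

(** The two half sets [u |: T] and [v |: T] differ by at most 2D edges.  If
    [private_nbrs u v] is the larger of the two sets of private neighbours,
    there is room for a [T] that avoids the smaller one and contains all of the
    larger one, or else is contained in it; in the second case the exchange
    would gain [n./2.-1] edges, which the bound on [D] excludes. *)
Lemma private_nbrs_le (R : realFieldType) (G : sgraph) (D : R) (u v : G) :
  half_sets_within G D -> u != v -> 2 * D < (#|G|./2.-1)%:R ->
  #|private_nbrs u v|%:R <= 2 * D.
Proof.
move=> hD u_v Dm.
wlog le_p : u v u_v / (#|private_nbrs v u| <= #|private_nbrs u v|)%N.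
  move=> W; have [le_p|lt_p] := leqP #|private_nbrs v u| #|private_nbrs u v|.
    exact: W.
  have le2 : #|private_nbrs v u|%:R <= 2 * D.
    by apply: W; rewrite 1?eq_sym // ltnW.
  by apply: le_trans le2; rewrite ler_nat ltnW.
set m := #|G|./2 in Dm.
have [S0 _ cS0] : exists2 S : {set G}, S \subset [set: G] & #|S| = m.
  by apply: exists_subset_of_card; rewrite cardsT /m; lia.
have D0 : 0 <= D := le_trans (normr_ge0 _) (hD _ cS0).
have m1 : (1 < m)%N.
  by have := le_lt_trans (mulr_ge0 (ler0n R 2) D0) Dm; rewrite ltr0n; lia.
set P := private_nbrs u v; set Q := private_nbrs v u.
pose Y := ~: [set u; v] :\: Q.
have sPY : P \subset Y.
  by apply/subsetP => w; rewrite !inE => /and4P[/negbTE -> /negbTE -> -> /negbTE ->].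
have sQ : Q \subset ~: [set u; v].
  by apply/subsetP => w; rewrite !inE => /and4P[/negbTE -> /negbTE ->].
have cuv : #|~: [set u; v]| = (#|G| - 2)%N by rewrite cardsCs setCK cards2 u_v.
have cY : #|Y| = (#|G| - 2 - #|Q|)%N by rewrite cardsD (setIidPr sQ) cuv.
have cPY := subset_leq_card sPY.
(* no vertex of T is private to v, so the exchange gains #|P :&: T| edges *)
have key (T : {set G}) : T \subset Y -> #|T| = m.-1 -> #|P :&: T|%:R <= 2 * D.
  move=> sT cT.
  have uT : u \notin T by apply/negP => /(subsetP sT); rewrite !inE eqxx andbF.
  have vT : v \notin T by apply/negP => /(subsetP sT); rewrite !inE eqxx orbT andbF.
  have := hD (u |: T); rewrite cardsU1 uT cT -/m.
  have := hD (v |: T); rewrite cardsU1 vT cT -/m.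
  have em : (true + m.-1)%N = m by rewrite add1n prednK // ltnW.
  rewrite em => /(_ erefl) h1 /(_ erefl) h2; move: h1 h2.
  rewrite !edges_in_setU1 // !natrD.
  have -> : (\sum_(x in T) adj u x = \sum_(x in T) adj v x + #|P :&: T|)%N.
    rewrite -sum1_card [X in (_ + X)%N](eq_bigl (fun x => (x \in T) && (x \in P))); last first.
      by move=> x; rewrite inE andbC.
    rewrite big_mkcondr -big_split /=; apply: eq_bigr => x xT.
    have := subsetP sT _ xT; rewrite !inE.
    by case: eqP => // _; case: eqP => // _; case: (adj u x); case: (adj v x).
  rewrite natrD; set a := (edges_in T)%:R; set b := _%:R;
  set c := #|P :&: T|%:R.
  set z := _ / 16 => h1 h2.
  have := ler_norm (a + (b + c) - z); have := ler_norm (- (a + b - z)).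
  rewrite normrN; lra.
have [Pm|mP] := leqP #|P| m.-1.
  have [|T [sPT sTY cT]] := exists_set_between (m := m.-1) sPY.
    rewrite Pm cY /m; move: le_p cPY; rewrite -/P -/Q cY; lia.
  by have := key T sTY cT; rewrite (setIidPl sPT).
have [T sT cT] := exists_subset_of_card (ltnW mP).
have := key T (subset_trans sT sPY) cT; rewrite (setIidPr sT) cT; lra.
Qed.

Definition nbrs (G : sgraph) (a : G) : {set G} := [set w | adj a w].

Definition nonnbrs (G : sgraph) (a : G) : {set G} :=
  [set w | (w != a) && ~~ adj a w].

Lemma card_nbrs_nonnbrs (G : sgraph) (a : G) :
  (#|nbrs a| + #|nonnbrs a|).+1 = #|G|.
Proof.
rewrite -[RHS]cardsT -(cardsID (nbrs a) [set: G]) setTI -addnS; congr addn.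
have -> : [set: G] :\: nbrs a = a |: nonnbrs a.
  by apply/setP => w; rewrite !inE andbT; case: eqP => // ->; rewrite adj_irr.
by rewrite cardsU1 !inE eqxx.
Qed.

(** Take a neighbour [v] and a non-neighbour [w] of [a].  If [v] and [w] are
    adjacent then [w] is private to [v] against [a]; otherwise [v] is private to
    [a] against [w].  Both kinds of pairs are rare. *)
Lemma mul_card_nbrs_nonnbrs_le (R : realFieldType) (G : sgraph) (D : R) (a : G) :
  half_sets_within G D -> 2 * D < (#|G|./2.-1)%:R ->
  (#|nbrs a| * #|nonnbrs a|)%:R <= 2 * D * (#|nbrs a|%:R + #|nonnbrs a|%:R).
Proof.
move=> hD Dm.
have le_count : (#|nbrs a| * #|nonnbrs a| <=
    \sum_(v in nbrs a) #|private_nbrs v a| +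
    \sum_(w in nonnbrs a) #|private_nbrs a w|)%N.
  have -> : (#|nbrs a| * #|nonnbrs a| =
      \sum_(v in nbrs a) \sum_(w in nonnbrs a) 1)%N.
    by rewrite sum_nat_const sum1_card.
  apply: (@leq_trans (\sum_(v in nbrs a) \sum_(w in nonnbrs a)
      ((w \in private_nbrs v a) + (v \in private_nbrs a w)))%N).
    apply: leq_sum => v; rewrite inE => av; apply: leq_sum => w.
    rewrite !inE => /andP[w_a aw].
    have v_a : v != a by apply/eqP => E; move: av; rewrite E adj_irr.
    have w_v : w != v by apply/eqP => E; move: aw; rewrite E av.
    rewrite av w_a aw v_a w_v [v == w]eq_sym w_v [adj w v]adj_sym.
    by case: (adj v w).
  under eq_bigr do rewrite big_split.
  rewrite big_split /= [X in (_ + X <= _)%N]exchange_big /=.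
  have count_in (A B : {set G}) : (\sum_(x in A) (x \in B) <= #|B|)%N.
    rewrite -big_mkcondr sum1_card subset_leq_card //.
    by apply/subsetP => x /andP[].
  by apply: leq_add; apply: leq_sum => x _; apply: count_in.
apply: (@le_trans _ _ (\sum_(v in nbrs a) #|private_nbrs v a| +
    \sum_(w in nonnbrs a) #|private_nbrs a w|)%N%:R); first by rewrite ler_nat.
rewrite natrD !natr_sum mulrDr.
have const_le (A : {set G}) (F : G -> nat) :
    (forall x, x \in A -> (F x)%:R <= 2 * D) ->
    \sum_(x in A) (F x)%:R <= 2 * D * #|A|%:R.
  by move=> h; rewrite mulr_natr -sumr_const; apply: ler_sum.
apply: lerD; apply: const_le => x; rewrite inE.
  move=> ax; apply: private_nbrs_le => //.
  by apply/eqP => E; move: ax; rewrite E adj_irr.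
by case/andP=> x_a _; apply: private_nbrs_le; rewrite 1?eq_sym.
Qed.

Lemma half_nat_bounds (R : realFieldType) (n : nat) :
  n%:R / 2 - 1 / 2 <= n./2%:R :> R /\ n./2%:R <= n%:R / 2 :> R.
Proof.
have := odd_double_half n; move/(congr1 (fun k => k%:R : R)).
by rewrite natrD -mul2n natrM; case: (odd n) => /=; lra.
Qed.

Lemma edges_in_deg (G : sgraph) (S : {set G}) :
  (edges_in S).*2 = (\sum_(x in S) #|nbrs x :&: S|)%N.
Proof.
rewrite edges_in_double; apply: eq_bigr => x xS.
rewrite -sum1_card [RHS](eq_bigl (fun y => (y \in S) && adj x y)); last first.
  by move=> y; rewrite !inE andbC.
by rewrite big_mkcondr; apply: eq_bigr => y _; case: adj.
Qed.

(** The sum of the numbers of neighbours and non-neighbours of a vertex is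
    [n - 1], so [mul_card_nbrs_nonnbrs_le] makes one of the two at most 4D.  If
    it is the same one for every vertex, a half set has far too few or far too
    many edges.  If it is not, a vertex adjacent to almost all others and one
    adjacent to almost none differ in almost all of [G], against
    [private_nbrs_le]. *)
Lemma order_le_deviation_large (R : realFieldType) (G : sgraph) (D : R) :
  half_sets_within G D -> (8 <= #|G|)%N -> #|G|%:R <= 768 * D.
Proof.
move=> hD n8; set n : R := #|G|%:R.
have n8R : 8 <= n by rewrite ler_nat.
pose m := #|G|./2; have [mlo mhi] := half_nat_bounds R #|G|; rewrite -/m -/n in mlo mhi.
have m4 : (4 <= m)%N by rewrite /m; lia.
have pm : (m.-1)%:R = m%:R - 1 :> R.
  by rewrite -[in RHS](prednK (ltnW (ltnW (ltnW m4)))) -addn1 natrD addrK.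
have [Dm|mD] := ltP (2 * D) (m.-1)%:R; last by rewrite pm in mD; lra.
have [S _ cS] : exists2 S : {set G}, S \subset [set: G] & #|S| = m.
  by apply: exists_subset_of_card; rewrite cardsT /m; lia.
have D0 : 0 <= D := le_trans (normr_ge0 _) (hD _ cS).
have := hD _ cS; rewrite ler_norml => /andP[elo ehi]; rewrite -/n in elo ehi.
have dich (a : G) : #|nbrs a|%:R <= 4 * D \/ #|nonnbrs a|%:R <= 4 * D.
  have := mul_card_nbrs_nonnbrs_le a hD Dm; rewrite natrM.
  have : #|nbrs a|%:R + #|nonnbrs a|%:R = n - 1 :> R.
    by have := congr1 (fun k => k%:R : R) (card_nbrs_nonnbrs a);
      rewrite -addn1 !natrD -/n; lra.
  set d : R := #|nbrs a|%:R; set d' : R := #|nonnbrs a|%:R => e h.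
  by have [?|?] := leP d d'; [left|right]; nra.
have [sparse|] := boolP [forall a : G, #|nbrs a|%:R <= 4 * D].
  have : (edges_in S).*2%:R <= 4 * D * m%:R.
    rewrite edges_in_deg natr_sum -cS mulr_natr -sumr_const.
    apply: ler_sum => x xS; apply: le_trans (forallP sparse x).
    by rewrite ler_nat subset_leq_card // subsetIl.
  by rewrite -mul2n natrM; nra.
rewrite negb_forall => /existsP[a]; rewrite -ltNge => bigN.
have {bigN} fewa : #|nonnbrs a|%:R <= 4 * D by case: (dich a) => //; lra.
have [dense|] := boolP [forall b : G, #|nonnbrs b|%:R <= 4 * D].
  have : m%:R * (m%:R - 1 - 4 * D) <= (edges_in S).*2%:R.
    rewrite edges_in_deg natr_sum -{1}cS mulr_natl -sumr_const.
    apply: ler_sum => x xS.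
    have : (m.-1 <= #|nbrs x :&: S| + #|nonnbrs x|)%N.
      have -> : m.-1 = #|S :\ x| by rewrite -cS (cardsD1 x S) xS.
      apply: leq_trans (leq_card_setU _ _).
      apply/subset_leq_card/subsetP => y; rewrite !inE.
      by case: eqP => //=; case: adj => //= _ ->.
    rewrite -(ler_nat R) natrD pm.
    by have := forallP dense x; lra.
  by rewrite -mul2n natrM; nra.
rewrite negb_forall => /existsP[b]; rewrite -ltNge => bigN.
have fewb : #|nbrs b|%:R <= 4 * D by case: (dich b) => //; lra.
have a_b : a != b by apply/eqP => E; move: bigN; rewrite -E; lra.
have := private_nbrs_le hD a_b Dm.
have : (#|G| <= #|private_nbrs a b| + #|nonnbrs a| + #|nbrs b| + 2)%N.
  have -> : 2%N = #|[set a; b]| by rewrite cards2 a_b.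
  rewrite -cardsT.
  apply: leq_trans (leq_trans (leq_card_setU
      (private_nbrs a b :|: nonnbrs a :|: nbrs b) [set a; b]) _).
    apply/subset_leq_card/subsetP => y; rewrite !inE => _.
    by case: (y =P a) => //=; case: (y =P b) => //=; case: (adj a y); case: (adj b y).
  rewrite leq_add2r; apply: leq_trans (leq_card_setU _ _) _.
  by rewrite leq_add2r leq_card_setU.
rewrite -(ler_nat R) !natrD -/n; lra.
Qed.

(** Below order 8 a half set of a complete graph may span about n^2/16 edges, and
    the deviation is bounded by integrality instead: [16] does not divide
    [n ^ 2] unless [n] is [0] or [4].  For [n = 4] and [G] not complete, a
    pair of non-adjacent vertices is a half set without edges. *)
Lemma order_le_deviation (R : realFieldType) (G : sgraph) (D : R) :
  ~ (#|G| = 4%N /\ complete_graph G) ->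
  half_sets_within G D -> #|G|%:R <= 768 * D.
Proof.
move=> nK4 hD.
have [|n8] := leqP 8 #|G|; first exact: order_le_deviation_large.
have n7R : #|G|%:R <= 7 :> R by rewrite (ler_nat R _ 7).
have [S _ cS] : exists2 S : {set G}, S \subset [set: G] & #|S| = #|G|./2.
  by apply: exists_subset_of_card; rewrite cardsT; lia.
have dev := hD _ cS.
have D0 : 0 <= D := le_trans (normr_ge0 _) dev.
have [->|n_pos] := posnP #|G|; first by rewrite mulr_ge0.
have [n4|n4] := eqVneq #|G| 4%N.
  have [u [v [u_v uv]]] : exists u v : G, u != v /\ ~~ adj u v.
    have [/existsP[u /existsP[v /andP[? ?]]]|] :=
        boolP [exists u : G, [exists v : G, (u != v) && ~~ adj u v]].
      by exists u, v.
    rewrite negb_exists => /forallP all_adj; case: nK4; split=> // u v u_v.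
    move: (all_adj u); rewrite negb_exists => /forallP/(_ v).
    by rewrite u_v /= negbK.
  have := hD [set u; v]; rewrite cards2 u_v n4 => /(_ erefl).
  rewrite edges_in_setU1; last by rewrite inE.
  have -> : edges_in [set v] = 0%N.
    by apply: double_inj; rewrite edges_in_double !big_set1 adj_irr.
  rewrite big_set1 (negbTE uv) addn0 ler_norml; lra.
suff : 1 <= 16 * `|(edges_in S)%:R - #|G|%:R ^+ 2 / 16| :> R by lra.
have -> : 16 * `|(edges_in S)%:R - #|G|%:R ^+ 2 / 16| =
    `|((16 * edges_in S)%N%:Z - (#|G| ^ 2)%N%:Z)%:~R| :> R.
  have e16 : 16 = `|16| :> R by rewrite ger0_norm.
  rewrite {1}e16 -normrM rmorphB /= -!pmulrn natrX natrM.
  by congr `|_|; field.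
rewrite -intr_norm (ler_int R 1) -gtz0_ge1 normr_gt0 subr_eq0.
apply/eqP => E; have {}E : (16 * edges_in S = #|G| ^ 2)%N by lia.
move: (edges_in S) #|G| E n4 n8 n_pos => e n.
by case: n => [|[|[|[|[|[|[|[|n]]]]]]]] //; lia.
Qed.

(** * Quadratic forms on fractional sets *)

Definition bilform (R : realFieldType) (T : finType) (M : T -> T -> R)
    (f g : T -> R) : R :=
  \sum_x \sum_y M x y * f x * g y.

Lemma eq_bilform (R : realFieldType) (T : finType) (M : T -> T -> R)
    (f f' g g' : T -> R) :
  f =1 f' -> g =1 g' -> bilform M f g = bilform M f' g'.
Proof.
by move=> ef eg; apply: eq_bigr => x _; apply: eq_bigr => y _; rewrite ef eg.
Qed.

Lemma bilform_linl (R : realFieldType) (T : finType) (M : T -> T -> R)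
    (a b : R) (f f' g : T -> R) :
  bilform M (fun x => a * f x + b * f' x) g
  = a * bilform M f g + b * bilform M f' g.
Proof.
rewrite /bilform !mulr_sumr -big_split; apply: eq_bigr => x _ /=.
by rewrite !mulr_sumr -big_split; apply: eq_bigr => y _ /=; ring.
Qed.

Lemma bilformC (R : realFieldType) (T : finType) (M : T -> T -> R)
    (f g : T -> R) :
  (forall x y, M x y = M y x) -> bilform M f g = bilform M g f.
Proof.
move=> symM; rewrite /bilform exchange_big; apply: eq_bigr => x _ /=.
by apply: eq_bigr => y _; rewrite symM; ring.
Qed.

Lemma bilform_linr (R : realFieldType) (T : finType) (M : T -> T -> R)
    (a b : R) (f f' g : T -> R) :
  bilform M g (fun x => a * f x + b * f' x)
  = a * bilform M g f + b * bilform M g f'.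
Proof.
rewrite /bilform !mulr_sumr -big_split; apply: eq_bigr => x _ /=.
by rewrite !mulr_sumr -big_split; apply: eq_bigr => y _ /=; ring.
Qed.

Lemma bilform_delta (R : realFieldType) (T : finType) (M : T -> T -> R)
    (u : T) (g : T -> R) :
  bilform M (fun x => (x == u)%:R) g = \sum_y M u y * g y.
Proof.
rewrite /bilform (bigD1 u) //= [X in _ + X]big1 ?addr0 => [|x /negbTE x_u].
  by apply: eq_bigr => y _; rewrite eqxx mulr1.
by apply: big1 => y _; rewrite x_u mulr0 mul0r.
Qed.

Lemma bilform_transfer (R : realFieldType) (T : finType) (M : T -> T -> R)
    (f : T -> R) (u v : T) (t : R) :
  (forall x y, M x y = M y x) ->
  let f' x := f x + t * ((x == u)%:R - (x == v)%:R) in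
  bilform M f' f' = bilform M f f
    + t * 2 * (\sum_y M u y * f y - \sum_y M v y * f y)
    + t ^+ 2 * (M u u + M v v - 2 * M u v).
Proof.
move=> symM f'.
pose e x : R := 1 * (x == u)%:R + (- 1) * (x == v)%:R.
have ef' : f' =1 (fun x => 1 * f x + t * e x) by move=> x; rewrite /f' /e; ring.
have delta2 z w : bilform M (fun x => (x == z)%:R) (fun x => (x == w)%:R) = M z w.
  rewrite bilform_delta (bigD1 w) //= eqxx mulr1 big1 ?addr0 // => y /negbTE ->.
  by rewrite mulr0.
have eg g : bilform M e g = \sum_y M u y * g y - \sum_y M v y * g y.
  by rewrite bilform_linl !bilform_delta; ring.
have ee : bilform M e e = M u u + M v v - 2 * M u v.
  by rewrite bilform_linl !bilform_linr !delta2 (symM v u); ring.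
clearbody e; rewrite (eq_bilform M ef' ef') bilform_linl !bilform_linr.
by rewrite (bilformC f e symM) eg ee; ring.
Qed.

(** As long as two coordinates are fractional, convexity lets weight move between
    them, in the direction in which the form does not decrease, until one of
    them becomes 0 or 1.  A single fractional coordinate cannot occur because
    the total weight is an integer. *)
Lemma bilform_le_of_indicators (R : realFieldType) (T : finType)
    (M : T -> T -> R) (K : R) (m : nat) :
  (forall x y, M x y = M y x) ->
  (forall u v, 0 <= M u u + M v v - 2 * M u v) ->
  (forall S : {set T}, #|S| = m ->
     bilform M (fun x => (x \in S)%:R) (fun x => (x \in S)%:R) <= K) ->
  forall f : T -> R, (forall x, 0 <= f x <= 1) -> \sum_x f x = m%:R ->
    bilform M f f <= K.
Proof.
move=> symM convM leK f.
have [k] := ubnP #|[set x | 0 < f x < 1]|; elim: k f => // k IH f le_k f01 sumf.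
have integral x : ~~ (0 < f x < 1) -> f x = (f x == 1)%:R.
  have /andP[f0 f1] := f01 x; case: eqP => //= ne1.
  by rewrite !lt_neqAle f0 f1 (introN eqP ne1) eq_sym !andbT negbK => /eqP.
have [u fu|noF] := pickP (fun x => 0 < f x < 1); last first.
  pose S := [set x | f x == 1].
  have ef : f =1 (fun x => (x \in S)%:R).
    by move=> x; rewrite inE; apply: integral; rewrite noF.
  rewrite (eq_bilform M ef ef); apply: leK; apply/eqP.
  rewrite -(eqr_nat R) -sumf (eq_bigr _ (fun x _ => ef x)) -natr_sum.
  by rewrite -big_mkcond sum1_card.
(* if u were the only fractional coordinate, the sum would not be an integer *)
have [v /andP[v_u fv]|noF] := pickP (fun x => (x != u) && (0 < f x < 1)); last first.
  have := sumf; rewrite (bigD1 u) //= (eq_bigr (fun x => (f x == 1)%:R)); last first.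
    by move=> x x_u; apply: integral; have := noF x; rewrite x_u /= => ->.
  rewrite -natr_sum; set c := (\sum_(_ | _) _)%N => e.
  have lo : c%:R < m%:R :> R by case/andP: fu; lra.
  have hi : m%:R < c.+1%:R :> R by rewrite -addn1 natrD; case/andP: fu; lra.
  by move: lo hi; rewrite !ltr_nat ltnS; lia.
wlog Lge0 : u v v_u fu fv / 0 <= \sum_y M u y * f y - \sum_y M v y * f y.
  move=> W; have [?|?] :=
      leP 0 (\sum_y M u y * f y - \sum_y M v y * f y); first exact: (W u v).
  by apply: (W v u) => //; [rewrite eq_sym|lra].
have /andP[fu0 fu1] := fu; have /andP[fv0 fv1] := fv.
(* the largest transfer that stays in [0, 1] *)
pose t := Num.min (1 - f u) (f v).
have t0 : 0 < t by rewrite lt_min; apply/andP; split; lra.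
have tu : t <= 1 - f u by rewrite ge_min lexx.
have tv : t <= f v by rewrite ge_min lexx orbT.
pose f' x := f x + t * ((x == u)%:R - (x == v)%:R).
have f'u : f' u = f u + t by rewrite /f' eqxx [u == v]eq_sym (negbTE v_u) /=; ring.
have f'v : f' v = f v - t by rewrite /f' eqxx (negbTE v_u) /=; ring.
have f'x x : x != u -> x != v -> f' x = f x.
  by move=> /negbTE xu /negbTE xv; rewrite /f' xu xv /=; ring.
have f'01 x : 0 <= f' x <= 1.
  have [->|xu] := eqVneq x u; first by rewrite f'u; apply/andP; split; lra.
  have [->|xv] := eqVneq x v; first by rewrite f'v; apply/andP; split; lra.
  by rewrite f'x.
apply: (@le_trans _ _ (bilform M f' f')).
  by rewrite bilform_transfer //; have := convM u v; nra.
apply: IH => //; last first.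
  rewrite big_split /= sumf -mulr_sumr sumrB -!natr_sum.
  have sum_eq z : (\sum_x (x == z) = 1)%N.
    by rewrite (bigD1 z) //= eqxx big1 // => y /negbTE ->.
  by rewrite !sum_eq subrr mulr0 addr0.
rewrite ltnS in le_k; apply: leq_trans le_k; apply: proper_card.
apply/properP; split.
  apply/subsetP => x; rewrite !inE.
  have [->|xu] := eqVneq x u; first by rewrite fu.
  have [->|xv] := eqVneq x v; first by rewrite fv.
  by rewrite f'x.
have [tE|tE] : t = 1 - f u \/ t = f v.
  by rewrite /t; case: (leP (1 - f u) (f v)); [left|right].
- exists u; rewrite inE ?fu // f'u tE.
  have -> : f u + (1 - f u) = 1 by ring.
  by rewrite ltxx andbF.
- by exists v; rewrite inE ?fv // f'v tE subrr ltxx.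
Qed.

(** * The bias of a graph with balanced half sets *)

Definition bias (R : realFieldType) (G : sgraph) (x y : G) : R :=
  (adj x y)%:R - (x != y)%:R / 2.

Lemma bias_sym (R : realFieldType) (G : sgraph) (x y : G) :
  bias R x y = bias R y x.
Proof. by rewrite /bias adj_sym eq_sym. Qed.

Lemma bilform_bias_indicator (R : realFieldType) (G : sgraph) (S : {set G}) :
  bilform (@bias R G) (fun x => (x \in S)%:R) (fun x => (x \in S)%:R)
  = 2 * (edges_in S)%:R - (#|S|%:R ^+ 2 - #|S|%:R) / 2.
Proof.
have sum_in (F : G -> R) : \sum_x F x * (x \in S)%:R = \sum_(x in S) F x.
  rewrite [RHS]big_mkcond; apply: eq_bigr => x _.
  by case: ifP; rewrite ?mulr1 ?mulr0.
rewrite /bilform.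
under eq_bigr do rewrite sum_in -mulr_suml.
rewrite sum_in.
have -> : 2 * (edges_in S)%:R = \sum_(x in S) \sum_(y in S) (adj x y)%:R :> R.
  rewrite -natrM mul2n edges_in_double natr_sum.
  by apply: eq_bigr => x _; rewrite natr_sum.
have row x : x \in S -> \sum_(y in S) bias R x y =
    \sum_(y in S) (adj x y)%:R - (#|S|%:R - 1) / 2.
  move=> xS; rewrite sumrB -mulr_suml; congr (_ - _ / 2).
  rewrite (eq_bigr (fun y => 1 - (y == x)%:R)) => [|y _]; last first.
    by rewrite eq_sym; case: eqP; rewrite ?subrr ?subr0.
  rewrite sumrB sumr_const (bigD1 x) //= eqxx big1 ?addr0 // => y.
  by case/andP=> _ /negbTE ->.
by rewrite (eq_bigr _ row) sumrB sumr_const -mulr_natr; field.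
Qed.

(** With 1/2 on the diagonal, the bias and its negative both satisfy the convexity
    condition of [bilform_le_of_indicators], as the bias is at most 1/2 in
    absolute value.  The diagonal adds a nonnegative amount to the form, so it
    only has to be paid for on half sets. *)
Lemma half_weight_bias_le (R : realFieldType) (G : sgraph) (D : R) (f : G -> R) :
  half_sets_within G D ->
  (forall x, 0 <= f x <= 1) -> \sum_x f x = #|G|./2%:R ->
  `|bilform (@bias R G) f f| <= 2 * D + #|G|%:R.
Proof.
move=> hD f01 sumf; set n : R := #|G|%:R.
have [mlo mhi] := half_nat_bounds R #|G|; rewrite -/n in mlo mhi.
pose M (s : R) (x y : G) := s * bias R x y + (x == y)%:R / 2.
have bilM s g : bilform (M s) g g = s * bilform (@bias R G) g g + (\sum_x g x ^+ 2) / 2.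
  rewrite /bilform mulr_sumr mulr_suml -big_split; apply: eq_bigr => x _ /=.
  rewrite (bigD1 x) //= [in RHS](bigD1 x) //= mulrDr.
  rewrite (eq_bigr (fun y => s * (bias R x y * g x * g y))).
    by rewrite -mulr_sumr /M eqxx /=; ring.
  by move=> y y_x; rewrite /M [x == y]eq_sym (negbTE y_x) /=; ring.
have bound s : s ^+ 2 = 1 -> s * bilform (@bias R G) f f <= 2 * D + n.
  move=> s2; have s_pm : s = 1 \/ s = -1.
    have : (s == 1) || (s == -1) by rewrite -eqf_sqr s2 expr1n.
    by case/orP=> /eqP ->; [left|right].
  apply: (@le_trans _ _ (bilform (M s) f f)).
    by rewrite bilM lerDl divr_ge0 // sumr_ge0 // => x _; rewrite sqr_ge0.
  apply: (bilform_le_of_indicators (m := #|G|./2)) => // [x y|u v|S cS].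
  - by rewrite /M bias_sym eq_sym.
  - have [->|u_v] := eqVneq u v; first by lra.
    rewrite /M !eqxx (negbTE u_v) /bias !adj_irr !eqxx u_v /=.
    by case: (adj u v) => /=; case: s_pm => ->; lra.
  rewrite bilM bilform_bias_indicator cS.
  have -> : \sum_x ((x \in S)%:R : R) ^+ 2 = #|G|./2%:R.
    rewrite (eq_bigr (fun x => ((x \in S)%:R : R))) => [|x _].
      by rewrite -natr_sum -big_mkcond sum1_card cS.
    by case: (x \in S); rewrite ?expr1n ?expr0n.
  have n0 : 0 <= n by rewrite ler0n.
  have := hD S cS; rewrite ler_norml -/n => /andP[lo hi].
  have m0 : 0 <= #|G|./2%:R :> R by rewrite ler0n.
  set m : R := #|G|./2%:R in mlo mhi m0 *.
  have p1 : 0 <= n * (m - (n / 2 - 1 / 2)) by rewrite mulr_ge0 ?subr_ge0.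
  have p2 : 0 <= (n / 2 - m) * (n / 2 + m) by rewrite mulr_ge0 //; lra.
  have p3 : 0 <= (n / 2 - m) ^+ 2 by rewrite sqr_ge0.
  by case: s_pm => ->; lra.
rewrite ler_norml; have := bound 1; have := bound (-1).
rewrite sqrrN expr1n; move=> /(_ erefl) h1 /(_ erefl) h2; apply/andP; split; lra.
Qed.

(** Let [c] be the mean of functions of total weight [m]; it lies between 1/3 and
    1/2.  For a function [phi] of sum 0 with values in [-1/3, 1/3], both
    [c + phi] and [c - phi] are admissible, which bounds the constant, linear
    and quadratic parts of the form around [c] separately.  The quadratic part
    polarizes to a bilinear bound, and any [f] with values in [0, 1] is its mean
    plus a function of sum 0.  The constant 54 is 9 + 9/2 + 9/2 + 36, one term
    for each product of these parts. *)
Lemma bilform_cut_le (R : realFieldType) (T : finType) (M : T -> T -> R)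
    (K m : R) :
  (forall x y, M x y = M y x) -> (0 < #|T|)%N ->
  #|T|%:R / 3 <= m -> m <= #|T|%:R / 2 ->
  (forall f : T -> R, (forall x, 0 <= f x <= 1) -> \sum_x f x = m ->
     `|bilform M f f| <= K) ->
  forall f g : T -> R, (forall x, 0 <= f x <= 1) -> (forall x, 0 <= g x <= 1) ->
    `|bilform M f g| <= 54 * K.
Proof.
move=> symM T0 mlo mhi hK f g f01 g01.
set n : R := #|T|%:R in mlo mhi.
have n0 : 0 < n by rewrite ltr0n.
pose c := m / n; have cn : c * n = m by rewrite /c divfK // gt_eqF.
have c3 : 1 / 3 <= c by rewrite ler_pdivlMr //; lra.
have c2 : c <= 1 / 2 by rewrite ler_pdivrMr //; lra.
pose one (x : T) : R := 1.
have sum_one : \sum_x one x = n by rewrite sumr_const.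
have sum_lin a b (h k : T -> R) :
    \sum_x (a * h x + b * k x) = a * \sum_x h x + b * \sum_x k x.
  by rewrite big_split /= -!mulr_sumr.
have shift (phi : T -> R) : \sum_x phi x = 0 -> (forall x, `|phi x| <= 1 / 3) ->
    `|c ^+ 2 * bilform M one one + 2 * c * bilform M one phi + bilform M phi phi| <= K.
  move=> s0 b; have := hK (fun x => c * one x + 1 * phi x).
  rewrite sum_lin sum_one s0 cn mulr0 addr0.
  rewrite bilform_linl !bilform_linr (bilformC phi one symM) => h.
  have {h} := h _ erefl; set lhs := (X in `|X| <= _); set rhs := (X in _ -> `|X| <= _).
  have -> : lhs = rhs by rewrite /lhs /rhs; ring.
  apply=> x; have := b x; rewrite ler_norml /one => /andP[? ?].
  by apply/andP; split; lra.
have zz : c ^+ 2 * `|bilform M one one| <= K.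
  have := shift (fun=> 0) (big1_eq _ _).
  have small0 (x : T) : `|0 : R| <= 1 / 3 by rewrite normr0; lra.
  move/(_ small0).
  have bil0 k : bilform M k (fun=> 0) = 0.
    by apply: big1 => x _; apply: big1 => y _; rewrite mulr0.
  by rewrite !bil0 mulr0 !addr0 normrM ger0_norm // sqr_ge0.
have small (phi : T -> R) : \sum_x phi x = 0 -> (forall x, `|phi x| <= 1 / 3) ->
    2 * c * `|bilform M one phi| <= K /\ `|bilform M phi phi| <= 2 * K.
  move=> s0 b; have h1 := shift phi s0 b.
  have s0N : \sum_x ((-1) * phi x + 0 * phi x) = 0 by rewrite sum_lin s0 !mulr0 addr0.
  have bN x : `|(-1) * phi x + 0 * phi x| <= 1 / 3 by rewrite mul0r addr0 mulN1r normrN.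
  have := shift _ s0N bN.
  rewrite !(bilform_linl, bilform_linr).
  have -> : 2 * c * `|bilform M one phi| = `|2 * c * bilform M one phi|.
    by rewrite normrM (ger0_norm (_ : 0 <= 2 * c)) //; lra.
  move: zz h1; rewrite -[c ^+ 2 in X in X -> _]ger0_norm ?sqr_ge0 // -normrM.
  rewrite !ler_norml => /andP[? ?] /andP[? ?] /andP[? ?].
  by split; apply/andP; split; lra.
have cross (phi psi : T -> R) : \sum_x phi x = 0 -> \sum_x psi x = 0 ->
    (forall x, `|phi x| <= 1) -> (forall x, `|psi x| <= 1) ->
    `|bilform M phi psi| <= 36 * K.
  move=> s0 s0' b b'.
  (* a sixth of phi plus or minus a sixth of psi stays in [-1/3, 1/3] *)
  have sixth (s : R) : `|s| <= 1 / 6 ->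
      `|bilform M (fun x => 1 / 6 * phi x + s * psi x)
                  (fun x => 1 / 6 * phi x + s * psi x)| <= 2 * K.
    move=> hs; have [||//] := small (fun x => 1 / 6 * phi x + s * psi x).
      by rewrite sum_lin s0 s0' !mulr0 addr0.
    move=> x; apply: le_trans (ler_normD _ _) _; rewrite (normrM (1 / 6)) (normrM s).
    have : `|s| * `|psi x| <= 1 / 6 * 1 by apply: ler_pM.
    by have := b x; rewrite (ger0_norm (_ : 0 <= 1 / 6)); lra.
  have := sixth (1 / 6); have := sixth (- (1 / 6)); rewrite normrN ger0_norm; last lra.
  move=> /(_ (lexx _)) + /(_ (lexx _)).
  rewrite !bilform_linl !bilform_linr (bilformC psi phi symM).
  rewrite !ler_norml => /andP[? ?] /andP[? ?].
  by apply/andP; split; lra.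
have lin (phi : T -> R) : \sum_x phi x = 0 -> (forall x, `|phi x| <= 1) ->
    `|bilform M one phi| <= 9 / 2 * K.
  move=> s0 b; have [||+ _] := small (fun x => 1 / 3 * phi x + 0 * phi x); last first.
  - rewrite bilform_linr mul0r addr0 normrM (ger0_norm (_ : 0 <= 1 / 3)); last lra.
    by have := normr_ge0 (bilform M one phi); nra.
  - move=> x; have := b x; rewrite !ler_norml => /andP[? ?].
    by apply/andP; split; lra.
  - by rewrite sum_lin s0 !mulr0 addr0.
have zz9 : `|bilform M one one| <= 9 * K.
  have c9 : 0 <= c ^+ 2 - 1 / 9 by nra.
  by have := mulr_ge0 c9 (normr_ge0 (bilform M one one)); lra.
have decomp (h : T -> R) : (forall x, 0 <= h x <= 1) ->
    exists a (phi : T -> R), [/\ 0 <= a <= 1, \sum_x phi x = 0,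
      forall x, `|phi x| <= 1 & h =1 (fun x => a * one x + 1 * phi x)].
  move=> h01; pose a := (\sum_x h x) / n.
  have an : a * n = \sum_x h x by rewrite /a divfK // gt_eqF.
  have a01 : 0 <= a <= 1.
    apply/andP; split.
      by rewrite divr_ge0 ?(ltW n0) // sumr_ge0 // => x _; case/andP: (h01 x).
    rewrite ler_pdivrMr // mul1r -sum_one ler_sum // => x _.
    by case/andP: (h01 x).
  exists a, (fun x => 1 * h x + (- a) * one x); split=> // [|x|x].
  - by rewrite sum_lin sum_one -an; ring.
  - have /andP[? ?] := h01 x; have /andP[? ?] := a01.
    by rewrite ler_norml /one; apply/andP; split; lra.
  - by rewrite /one; ring.
have [a [phi [/andP[a0 a1] sphi bphi ef]]] := decomp f f01.
have [b [psi [/andP[b0 b1] spsi bpsi eg]]] := decomp g g01.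
rewrite (eq_bilform M ef eg) bilform_linl !bilform_linr (bilformC phi one symM).
have := cross _ _ sphi spsi bphi bpsi; have := lin _ sphi bphi.
have := lin _ spsi bpsi; move: zz9.
set z := bilform M one one; set p := bilform M one phi.
set q := bilform M one psi; set r := bilform M phi psi => hz hq hp hr.
have shrink s (y B : R) : 0 <= s -> s <= 1 -> `|y| <= B -> `|s * y| <= B.
  move=> s0 s1 yB; rewrite normrM (ger0_norm s0).
  by have := normr_ge0 y; nra.
have := shrink _ _ _ a0 a1 (shrink _ _ _ b0 b1 hz).
have := shrink _ _ _ a0 a1 hq; have := shrink _ _ _ b0 b1 hp; move: hr.
rewrite !ler_norml => /andP[? ?] /andP[? ?] /andP[? ?] /andP[? ?].
by apply/andP; split; lra.
Qed.

(** * Embedding vertex by vertex *)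

(** [x] and [y] may be the images of two vertices of the pattern whose adjacency
    is [e]. *)
Definition compatible (G : sgraph) (e : bool) (x y : G) : bool :=
  (x != y) && (adj x y == e).

Lemma compatible_sym (G : sgraph) (e : bool) (x y : G) :
  compatible e x y = compatible e y x.
Proof. by rewrite /compatible eq_sym adj_sym. Qed.

(** The last term is the price of injectivity: tested against two functions with
    values in [0, 1] it costs at most [n / 2]. *)
Lemma compatibleE (R : realFieldType) (G : sgraph) (e : bool) (x y : G) :
  (compatible e x y)%:R = 1 / 2 + (-1) ^+ (~~ e) * bias R x y - (x == y)%:R / 2.
Proof.
rewrite /compatible /bias; have [->|_] := eqVneq x y.
  by rewrite adj_irr; case: e => /=; rewrite ?expr0 ?expr1; lra.
by case: e; case: (adj x y) => /=; rewrite ?expr0 ?expr1; lra.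
Qed.

(** Keeping only the [x] at which the expected half is missed turns the positive
    part into a plain difference without leaving the functions with values in
    [0, 1], so that the bound on the bilinear form applies. *)
Lemma total_shortfall_le (R : realFieldType) (G : sgraph) (K : R) (e : bool)
    (f g : G -> R) :
  (forall f g : G -> R, (forall x, 0 <= f x <= 1) -> (forall x, 0 <= g x <= 1) ->
     `|bilform (@bias R G) f g| <= K) ->
  (forall x, 0 <= f x <= 1) -> (forall x, 0 <= g x <= 1) ->
  \sum_x f x * Num.max 0
      ((\sum_y g y) / 2 - \sum_y g y * (compatible e x y)%:R)
  <= K + #|G|%:R / 2.
Proof.
move=> hK f01 g01.
pose gap x := (\sum_y g y) / 2 - \sum_y g y * (compatible e x y)%:R.
pose f' x := if 0 < gap x then f x else 0.
have f'01 x : 0 <= f' x <= 1.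
  by rewrite /f'; case: ifP => _ //; rewrite lexx ler01.
have gapE x : gap x = g x / 2 - (-1) ^+ (~~ e) * \sum_y bias R x y * g y.
  have -> : g x = \sum_y (x == y)%:R * g y.
    rewrite (bigD1 x) //= eqxx mul1r big1 ?addr0 // => y.
    by rewrite eq_sym => /negbTE ->; rewrite mul0r.
  rewrite /gap !mulr_suml mulr_sumr -!sumrB; apply: eq_bigr => y _.
  by rewrite compatibleE; field.
have -> : \sum_x f x * Num.max 0 (gap x) = \sum_x f' x * gap x.
  apply: eq_bigr => x _; rewrite /f'; case: ltP => //.
  by rewrite mulr0 mul0r.
have -> : \sum_x f' x * gap x =
    \sum_x f' x * g x / 2 - (-1) ^+ (~~ e) * bilform (@bias R G) f' g.
  rewrite /bilform mulr_sumr -sumrB; apply: eq_bigr => x _.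
  rewrite gapE mulrBr mulrA; congr (_ - _).
  rewrite !mulr_sumr; apply: eq_bigr => y _; ring.
have diag : \sum_x f' x * g x / 2 <= #|G|%:R / 2.
  rewrite -mulr_suml ler_pM2r; last lra.
  have -> : #|G|%:R = \sum_(x : G) (1 : R) by rewrite sumr_const.
  apply: ler_sum => x _; have /andP[? ?] := f'01 x; have /andP[? ?] := g01 x; nra.
have := hK f' g f'01 g01; rewrite ler_norml => /andP[? ?].
have [->|->] : (-1) ^+ (~~ e) = 1 :> R \/ (-1) ^+ (~~ e) = -1 :> R.
- by case: (e); [left|right].
- by lra.
- by lra.
Qed.

Lemma prodr_const_size (R : realFieldType) (I : Type) (s : seq I) (c : R) :
  \prod_(j <- s) c = c ^+ size s.
Proof.
by rewrite big_const_seq count_predT; elim: (size s) => //= k ->; rewrite exprS.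
Qed.

(** The errors add up, rather than multiply, because every factor is at most [B].
    [B ^+ size s / B] is the product of the other factors' bounds; in the empty
    case it is multiplied by 0. *)
Lemma prod_ge_of_shortfall (R : realFieldType) (I : eqType) (s : seq I) (B : R)
    (y z d : I -> R) :
  0 < B ->
  (forall j, j \in s -> [/\ 0 <= y j <= B, 0 <= z j <= B, 0 <= d j & z j - d j <= y j]) ->
  \prod_(j <- s) z j - B ^+ size s / B * \sum_(j <- s) d j <= \prod_(j <- s) y j.
Proof.
move=> B0; elim: s => [|h s IH] hs.
  by rewrite !big_nil /=; lra.
have hs' j : j \in s -> [/\ 0 <= y j <= B, 0 <= z j <= B, 0 <= d j & z j - d j <= y j].
  by move=> js; apply: hs; rewrite inE js orbT.
have [/andP[y0 yB] /andP[z0 zB] d0 zdy] := hs h (mem_head _ _).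
rewrite !big_cons /=; have {IH} := IH hs'.
have pz0 : 0 <= \prod_(j <- s) z j.
  by rewrite big_seq prodr_ge0 // => j /hs'[_ /andP[]].
have pzB : \prod_(j <- s) z j <= B ^+ size s.
  by rewrite -prodr_const_size !big_seq; apply: ler_prod => j /hs'[_ ? _ _].
have sd0 : 0 <= \sum_(j <- s) d j.
  by rewrite big_seq sumr_ge0 // => j /hs'[].
rewrite exprS -[B * _ / B]mulrA.
set P := \prod_(j <- s) z j in pz0 pzB *; set Q := \prod_(j <- s) y j.
set S := \sum_(j <- s) d j in sd0 *.
have c0 : 0 <= B ^+ size s / B by rewrite divr_ge0 ?exprn_ge0 // ltW.
have e : B ^+ size s = B * (B ^+ size s / B) by rewrite mulrCA divff ?mulr1 // gt_eqF.
move: pzB; rewrite [X in _ <= X]e; move: (B ^+ size s / B) c0 => c c0 pzB le.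
have t1 : 0 <= y h * (Q - (P - c * S)) by rewrite mulr_ge0 // subr_ge0.
have t2 : 0 <= (y h - (z h - d h)) * P by rewrite mulr_ge0 // subr_ge0.
have t3 : 0 <= d h * (B * c - P) by rewrite mulr_ge0 // subr_ge0.
have t4 : 0 <= (B - y h) * (c * S) by rewrite mulr_ge0 ?subr_ge0 // mulr_ge0.
by lra.
Qed.

Definition copies_extending (H G : sgraph) (s : seq H) (p : {ffun H -> G}) :
    {set {ffun H -> G}} :=
  [set phi in induced_copies H G | [forall j, (j \notin s) ==> (phi j == p j)]].

Lemma card_copies_extending_cons (H G : sgraph) (h : H) (s : seq H)
    (p : {ffun H -> G}) :
  h \notin s ->
  #|copies_extending (h :: s) p|
  = (\sum_x #|copies_extending s [ffun j => if j == h then x else p j]|)%N.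
Proof.
move=> hs; rewrite -sum1_card (partition_big (fun phi : {ffun H -> G} => phi h) xpredT) //=.
apply: eq_bigr => x _; rewrite -sum1_card; apply: eq_bigl => phi.
rewrite !inE -andbA; congr (_ && _); apply/andP/forallP.
  case=> /forallP off /eqP phih j; apply/implyP => js; rewrite ffunE.
  have [->|jh] := eqVneq j h; first by rewrite phih.
  by apply: (implyP (off j)); rewrite inE negb_or jh.
move=> off; split.
  apply/forallP => j; apply/implyP; rewrite inE negb_or => /andP[jh js].
  by have := implyP (off j) js; rewrite ffunE (negbTE jh).
by have := implyP (off h) hs; rewrite ffunE eqxx.
Qed.

Lemma copies_extending_nil (H G : sgraph) (p : {ffun H -> G}) :
  (forall i j : H, i != j -> compatible (adj i j) (p i) (p j)) ->
  (0 < #|copies_extending [::] p|)%N.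
Proof.
move=> pcomp; apply/card_gt0P; exists p; rewrite !inE -andbA; apply/and3P; split.
- apply/injectiveP => i j pij; apply/eqP/negPn/negP => i_j.
  by have := pcomp i j i_j; rewrite /compatible pij eqxx.
- apply/forallP => i; apply/forallP => j.
  have [->|i_j] := eqVneq i j; first by rewrite !adj_irr.
  by case/andP: (pcomp i j i_j).
- by apply/forallP => j; rewrite eqxx implybT.
Qed.

(** The weights [w j] live on vertices that are still possible images of [j].  All
    weights total at most [mu], a bound that is halved at each placement.  The
    quotient [mu ^+ size s / mu ^+ 2] is the bound on the weights of all
    unplaced vertices but two, for the pair whose cut test failed; written in
    this way it also makes sense for fewer than two vertices.

    For the induction step let [t] vertices remain after [h] is placed and let
    [nu = mu / 2].  In units of [delta * nu ^+ t / nu], the shortfalls of this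
    step cost [t], the errors of later steps [2 * 6 ^+ t], and the statement
    allows [3 * 6 ^+ t], which is enough as [t <= 6 ^+ t]. *)
Lemma copies_extending_ge (R : realFieldType) (H G : sgraph) (K : R) :
  (forall f g : G -> R, (forall x, 0 <= f x <= 1) -> (forall x, 0 <= g x <= 1) ->
     `|bilform (@bias R G) f g| <= K) ->
  forall (s : seq H) (p : {ffun H -> G}) (w : H -> G -> R) (mu : R),
  uniq s -> 0 < mu ->
  (forall j x, 0 <= w j x <= 1) ->
  (forall i j, i \notin s -> j \notin s -> i != j ->
     compatible (adj i j) (p i) (p j)) ->
  (forall i j x, i \notin s -> j \in s -> 0 < w j x ->
     compatible (adj i j) (p i) x) ->
  (forall j, j \in s -> \sum_x w j x <= mu) ->
  2 ^- 'C(size s, 2) * (\prod_(j <- s) (\sum_x w j x)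
     - 6 ^+ size s * (K + #|G|%:R / 2) * (mu ^+ size s / mu ^+ 2))
  <= #|copies_extending s p|%:R.
Proof.
move=> hK; set delta := K + _; have delta0 : 0 <= delta.
  have z01 (x : G) : 0 <= (0 : R) <= 1 by rewrite lexx ler01.
  have hk := hK (fun=> 0) (fun=> 0) z01 z01.
  by rewrite addr_ge0 ?divr_ge0 //; apply: le_trans hk.
elim=> [|h s IH] p w mu; rewrite ?cons_uniq.
  move=> _ mu0 _ pcomp _ _; rewrite big_nil /= !expr0 invr1 !mul1r.
  apply: (@le_trans _ _ 1); last first.
    by rewrite (ler_nat R 1); apply: copies_extending_nil => i j; apply: pcomp.
  by rewrite lerBlDr lerDl mulr_ge0 // invr_ge0 exprn_ge0 // ltW.
case/andP=> hs us mu0 w01 pcomp wcomp wmu.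
rewrite card_copies_extending_cons // natr_sum big_cons.
set t := size s; set X := fun j => \sum_x w j x.
pose nu := mu / 2; have nu0 : 0 < nu by rewrite divr_gt0.
pose a j x y : R := w j y * (compatible (adj h j) x y)%:R.
pose mass j x := \sum_y a j x y.
pose r j x := if mass j x <= nu then 1 else nu / mass j x.
pose d j x := Num.max 0 (X j / 2 - mass j x).
have a01 j x y : 0 <= a j x y <= 1.
  rewrite /a; case: (compatible _ _ _); rewrite ?mulr1 ?mulr0 ?lexx ?ler01 //.
have r01 j x : 0 <= r j x <= 1.
  rewrite /r; case: (leP (mass j x) nu) => [_|lt]; first by rewrite ler01 lexx.
  have m0 := lt_trans nu0 lt.
  by rewrite ler_pdivrMr // mul1r (ltW lt) divr_ge0 // ltW.
have rmass j x : r j x * mass j x = Num.min (mass j x) nu.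
  rewrite /r; case: (leP (mass j x) nu) => [_|lt]; first by rewrite mul1r.
  by rewrite divfK // gt_eqF // (lt_trans nu0 lt).
have mass0 j x : 0 <= mass j x.
  by apply: sumr_ge0 => y _; case/andP: (a01 j x y).
(* only positions of positive weight are known to fit the placed vertices *)
have step x : 0 < w h x ->
    2 ^- 'C(t, 2) * (\prod_(j <- s) (X j / 2) - nu ^+ t / nu * \sum_(j <- s) d j x
      - 6 ^+ t * delta * (nu ^+ t / nu ^+ 2))
    <= #|copies_extending s [ffun j => if j == h then x else p j]|%:R.
  move=> wx0.
  have {IH} := IH [ffun j => if j == h then x else p j]
    (fun j y => r j x * a j x y) nu us nu0.
  have rsum j : \sum_y r j x * a j x y = Num.min (mass j x) nu.
    by rewrite -mulr_sumr -rmass.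
  move=> IH; apply: le_trans (IH _ _ _ _).
  - rewrite ler_pM2l ?invr_gt0 ?exprn_gt0 // lerB // (eq_bigr _ (fun j _ => rsum j)).
    apply: prod_ge_of_shortfall => // j js.
    have X0 : 0 <= X j by apply: sumr_ge0 => y _; case/andP: (w01 j y).
    have XB : X j <= mu by apply: wmu; rewrite inE js orbT.
    have := mass0 j x; rewrite /d /nu => m0.
    split.
    + by rewrite le_min ge_min m0 lexx orbT divr_ge0 // ltW.
    + by apply/andP; split; lra.
    + by rewrite le_max lexx.
    + by rewrite le_min; case: (leP 0 (X j / 2 - mass j x)) => ?; apply/andP; split; lra.
  - move=> j y; have /andP[? ?] := a01 j x y; have /andP[? ?] := r01 j x.
    by apply/andP; split; [rewrite mulr_ge0|rewrite mulr_ile1].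
  - move=> i j is_ js ij; rewrite !ffunE.
    have [ih|ih] := eqVneq i h; have [jh|jh] := eqVneq j h.
    + by move: ij; rewrite ih jh eqxx.
    + rewrite compatible_sym ih adj_sym; apply: wcomp; rewrite ?inE ?eqxx //.
      by rewrite negb_or jh.
    + by rewrite jh; apply: wcomp; rewrite ?inE ?eqxx // negb_or ih.
    + by apply: pcomp; rewrite // inE negb_or ?ih ?jh.
  - move=> i j y is_ js lt; rewrite ffunE.
    have a0 : 0 < a j x y.
      have /andP[a0 _] := a01 j x y; rewrite lt_neqAle a0 andbT eq_sym.
      by apply/eqP => E; move: lt; rewrite E mulr0 ltxx.
    have [->|ih] := eqVneq i h.
      by move: a0; rewrite /a; case: compatible => //; rewrite mulr0 ltxx.
    apply: wcomp; rewrite ?inE ?js ?orbT ?negb_or ?ih //.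
    have /andP[w0 _] := w01 j y; rewrite lt_neqAle w0 andbT eq_sym.
    by apply/eqP => E; move: a0; rewrite /a E mul0r ltxx.
  - by move=> j js; rewrite rsum ge_min lexx orbT.
apply: (@le_trans _ _ (\sum_x w h x * (2 ^- 'C(t, 2) * (\prod_(j <- s) (X j / 2)
      - nu ^+ t / nu * \sum_(j <- s) d j x
      - 6 ^+ t * delta * (nu ^+ t / nu ^+ 2))))); last first.
  apply: ler_sum => x _; have /andP[w0 w1] := w01 h x.
  have [w_eq0|w_gt0] := leP (w h x) 0.
    by have -> : w h x = 0; [apply/eqP; rewrite eq_le w_eq0|rewrite mul0r].
  apply: le_trans (_ : w h x * #|copies_extending s _|%:R <= _).
    by rewrite ler_pM2l //; apply: step.
  by rewrite ler_piMl.
have dsum : \sum_x w h x * \sum_(j <- s) d j x <= t%:R * delta.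
  rewrite (eq_bigr (fun x => \sum_(j <- s) w h x * d j x)) => [|x _]; last first.
    by rewrite mulr_sumr.
  rewrite exchange_big /= /t -sum1_size natr_sum mulr_suml.
  apply: ler_sum => j _; rewrite mul1r.
  exact: total_shortfall_le hK (w01 h) (w01 j).
have -> : \sum_x w h x * (2 ^- 'C(t, 2) * (\prod_(j <- s) (X j / 2)
      - nu ^+ t / nu * \sum_(j <- s) d j x
      - 6 ^+ t * delta * (nu ^+ t / nu ^+ 2))) =
   2 ^- 'C(t, 2) * (X h * (\prod_(j <- s) (X j / 2)
      - 6 ^+ t * delta * (nu ^+ t / nu ^+ 2))
      - nu ^+ t / nu * \sum_x w h x * \sum_(j <- s) d j x).
  rewrite /X mulr_suml mulr_sumr -sumrB mulr_sumr.
  by apply: eq_bigr => x _; ring.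
have prodE : \prod_(j <- s) (X j / 2) = 2 ^- t * \prod_(j <- s) X j.
  rewrite big_split /= mulrC; congr (_ * _).
  by rewrite prodr_const_size exprVn.
rewrite prodE [size _]/= -/t binS bin1 exprD invfM -[X in X <= _]mulrA.
rewrite ler_pM2l ?invr_gt0 ?exprn_gt0 // -/(X h).
have A0 : 0 <= nu ^+ t / nu by rewrite divr_ge0 ?exprn_ge0 // ltW.
have nu_neq0 : nu != 0 by rewrite gt_eqF.
have -> : nu ^+ t / nu ^+ 2 = nu ^+ t / nu / nu by field.
have mu2 : mu = 2 * nu by rewrite /nu; field.
have -> : mu ^+ t.+1 / mu ^+ 2 = 2 ^+ t * (nu ^+ t / nu / 2).
  rewrite mu2.
  by rewrite exprMn !exprS; field.
have Xh : X h / nu <= 2.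
  by rewrite ler_pdivrMr // -mu2; apply: wmu; rewrite mem_head.
have t6 : t%:R <= 6 ^+ t :> R by rewrite -natrX ler_nat ltnW // ltn_expl.
have two_t : 2 ^+ t != 0 :> R by rewrite expf_neq0 // pnatr_eq0.
rewrite exprS; set P := \prod_(j <- s) _; set S := \sum_x _ in dsum *.
move: (nu ^+ t / nu) A0 (6 ^+ t) t6 => A A0 c t6.
have -> : 2 ^- t * (X h * P - 6 * c * delta * (2 ^+ t * (A / 2))) =
    2 ^- t * (X h * P) - 3 * (c * delta * A) by field.
have -> : X h * (2 ^- t * P - c * delta * (A / nu)) - A * S =
    2 ^- t * (X h * P) - (X h / nu) * (c * delta * A) - A * S.
  by field; rewrite nu_neq0.
have c0 : 0 <= c by apply: le_trans t6.
have p1 : 0 <= (2 - X h / nu) * (c * delta * A) by rewrite !mulr_ge0 // subr_ge0.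
have p2 : 0 <= (c - t%:R) * (delta * A) by rewrite !mulr_ge0 // subr_ge0.
have p3 : 0 <= (t%:R * delta - S) * A by rewrite mulr_ge0 // subr_ge0.
by lra.
Qed.

(** For [n = 1] there are no fractional half sets of mean at least [1/3], but the
    bias vanishes. *)
Lemma bias_cut_le (R : realFieldType) (G : sgraph) (D : R) (f g : G -> R) :
  half_sets_within G D -> (0 < #|G|)%N ->
  (forall x, 0 <= f x <= 1) -> (forall x, 0 <= g x <= 1) ->
  `|bilform (@bias R G) f g| <= 54 * (2 * D + #|G|%:R).
Proof.
move=> hD n0 f01 g01; have [n1|n2] := leqP #|G| 1.
  have -> : bilform (@bias R G) f g = 0.
    apply: big1 => x _; apply: big1 => y _.
    have -> : y = x by apply: (fintype_le1P n1).
    by rewrite /bias adj_irr eqxx mul0r subrr !mul0r.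
  have [S _ cS] : exists2 S : {set G}, S \subset [set: G] & #|S| = #|G|./2.
    by apply: exists_subset_of_card; rewrite cardsT; lia.
  have D0 : 0 <= D := le_trans (normr_ge0 _) (hD _ cS).
  by rewrite normr0 mulr_ge0 // addr_ge0 // mulr_ge0.
have [_ mhi] := half_nat_bounds R #|G|.
apply: (bilform_cut_le (m := #|G|./2%:R)) => //; first exact: bias_sym.
  rewrite ler_pdivrMr // -natrM ler_nat; lia.
by move=> h h01 sumh; apply: half_weight_bias_le.
Qed.

(** * Conclusion *)

Theorem theorem1p3 (R : realType) :
  exists c : R, 0 < c /\
    forall (k n : nat) (H G : sgraph) (eps : R),
      #|H| = k -> #|G| = n ->
      ~ (n = 4%N /\ complete_graph G) ->
      #|induced_copies H G|%:R <= (1 - eps) * 2 ^- 'C(k, 2) * n%:R ^+ k ->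
      exists S : {set G},
        #|S| = n./2 /\
        `| (edges_in S)%:R - n%:R ^+ 2 / 16 | >= eps * c ^- k * n%:R ^+ 2.
Proof.
(* delta = 54 (2 D + n) + n / 2 <= 41964 D by n <= 768 D, and 205 ^ 2 is larger;
   6 * C absorbs both factors of 6 ^ k * C as soon as k > 0 *)
pose C : R := 205 * 205; have C1 : 1 <= C by rewrite /C; lra.
have C0 : 0 < C by apply: lt_le_trans C1.
have c0 : 0 < 6 * C by rewrite mulr_gt0.
exists (6 * C); split=> // k n H G eps cH cG nK4 few.
have [S0 _ cS0] : exists2 S : {set G}, S \subset [set: G] & #|S| = n./2.
  by apply: exists_subset_of_card; rewrite cardsT cG; lia.
pose dev (S : {set G}) : R := `|(edges_in S)%:R - n%:R ^+ 2 / 16|.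
have [S [cS maxS]] : exists S : {set G},
    #|S| = n./2 /\ forall S' : {set G}, #|S'| = n./2 -> dev S' <= dev S.
  case: (@arg_maxP _ _ _ S0 (fun S : {set G} => #|S| == n./2) dev); first exact/eqP.
  by move=> S /eqP cS maxS; exists S; split=> // S' /eqP; apply: maxS.
exists S; split=> //; rewrite -/(dev S); set D := dev S in maxS *.
have D0 : 0 <= D by rewrite normr_ge0.
have [eps0|eps_gt0] := leP eps 0.
  by apply: le_trans D0; rewrite -mulrA mulr_le0_ge0 // mulr_ge0 ?invr_ge0 ?exprn_ge0 // ltW.
have [n0|n_pos] := posnP n; first by rewrite n0 expr0n mulr0.
have k_pos : (0 < k)%N.
  rewrite lt0n; apply/eqP => k0; move: few; rewrite k0 expr0 invr1 !mulr1.
  have H0 (h : H) : False by have := max_card (pred1 h); rewrite card1 cH k0.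
  suff -> : #|induced_copies H G| = 1%N by rewrite lerBrDr gerDl leNgt eps_gt0.
  have -> : induced_copies H G = setT.
    apply/setP => phi; rewrite !inE; apply/andP; split.
      by apply/injectiveP => h; case: (H0 h).
    by apply/forallP => h; case: (H0 h).
  by rewrite cardsT card_ffun cH k0.
have hD : half_sets_within G D by move=> S' cS'; rewrite cG; apply: maxS; rewrite cS' cG.
have nD : n%:R <= 768 * D by rewrite -cG; apply: order_le_deviation; rewrite ?cG.
have nR : 0 < n%:R :> R by rewrite ltr0n.
have [x0 _] : exists x : G, x \in [set: G].
  by apply/set0Pn; rewrite -card_gt0 cardsT cG.
have one01 (T : Type) (x : T) : 0 <= (1 : R) <= 1 by rewrite ler01 lexx.
have mass_one : \sum_(x : G) (1 : R) = n%:R by rewrite sumr_const cG.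
have hK f g : (forall x : G, 0 <= f x <= 1) -> (forall x, 0 <= g x <= 1) ->
    `|bilform (@bias R G) f g| <= 54 * (2 * D + n%:R).
  by rewrite -cG; apply: bias_cut_le; rewrite ?cG.
have vacuous (Q : Prop) (i : H) : i \notin enum H -> Q by rewrite mem_enum.
have mass_le : \sum_(x : G) (1 : R) <= n%:R by rewrite mass_one.
have := @copies_extending_ge R H G _ hK (enum H) [ffun=> x0] (fun _ _ => 1)
  n%:R (enum_uniq _) nR (fun _ => one01 G) (fun i _ => @vacuous _ i)
  (fun i _ _ => @vacuous _ i) (fun _ _ => mass_le).
rewrite mass_one prodr_const_size -cardE cH cG => many.
have {few}few : #|copies_extending (enum H) [ffun=> x0]|%:R <=
    2 ^- 'C(k, 2) * ((1 - eps) * n%:R ^+ k).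
  apply: (@le_trans _ _ #|induced_copies H G|%:R).
    by rewrite ler_nat subset_leq_card //; apply/subsetP => phi; rewrite inE => /andP[].
  by rewrite mulrA [_ * (1 - eps)]mulrC.
have := le_trans many few; rewrite ler_pM2l ?invr_gt0 ?exprn_gt0 //.
set delta := 54 * _ + _ => le_delta.
have delta_le : delta <= C * D by rewrite /delta /C; lra.
have {le_delta}main : eps * n%:R ^+ 2 <= 6 ^+ k * delta.
  have nk : 0 < n%:R ^+ k / n%:R ^+ 2 :> R by rewrite divr_gt0 ?exprn_gt0.
  rewrite -(ler_pM2r nk) -[X in X <= _]mulrA [n%:R ^+ 2 * _]mulrC divfK ?expf_neq0 ?gt_eqF //.
  by move: le_delta; lra.
rewrite mulrAC ler_pdivrMr ?exprn_gt0 //; apply: le_trans main _.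
rewrite exprMn [D * _]mulrC -mulrA ler_pM2l ?exprn_gt0 //.
apply: le_trans delta_le _; rewrite ler_wpM2r //.
by rewrite -[X in X <= _]expr1 ler_weXn2l.
Qed.
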